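(* Let $\ell\geq 2$ and $k\geq 2$ be integers. Let $\mathcal{S}_{\ell,k}\subseteq\mathbb{R}^{\ell-1}$ be the closure of the set of points $$\left(\frac{\operatorname{hom}(S^{(k)}_{2k};G)}{\operatorname{hom}(S^{(k)}_{k};G)^2}, \frac{\operatorname{hom}(S^{(k)}_{3k};G)}{\operatorname{hom}(S^{(k)}_{k};G)^3}, \ldots, \frac{\operatorname{hom}(S^{(k)}_{\ell k};G)}{\operatorname{hom}(S^{(k)}_{k};G)^\ell}\right)$$ over all $k$-uniform hypergraphs $G$ with $\operatorname{hom}(S^{(k)}_{k};G)\neq 0$. Then $\mathcal{S}_{\ell,k}=\Pi_\ell$.
   Context: Hypergraphs are finite. For $k$-uniform hypergraphs $H,G$, $\operatorname{hom}(H;G)$ is the number of maps $V(H)\to V(G)$ such that the image of every hyperedge of $H$ is a hyperedge of $G$. $S^{(k)}_b$ denotes the $k$-uniform hyperstar with $b$ hyperedges (branches) which all share exactly one common vertex (the center) and are otherwise pairwise disjoint; for $k=2$ this is the star $K_{1,b}$. For $\mathbf{x}\in\mathbb{R}^n$ and $i\in\mathbb{N}$, $p_i(\mathbf{x})=\sum_{j=1}^n x_j^i$. Let $\Pi_{n,\ell}=\{(p_2(\mathbf{x}),\ldots,p_\ell(\mathbf{x})) : \mathbf{x}\in\mathbb{R}^n_{\geq 0},\ p_1(\mathbf{x})=1\}$ and the power-sum profile $\Pi_\ell=\operatorname{cl}\left(\bigcup_{n\in\mathbb{N}}\Pi_{n,\ell}\right)\subseteq\mathbb{R}^{\ell-1}$,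 where $\operatorname{cl}$ is topological closure. *)

(* Defs.v *)
From HB Require Import structures.
From mathcomp Require Import all_boot all_order all_algebra.
From mathcomp Require Import all_classical all_reals all_analysis.

Set Implicit Arguments.
Unset Strict Implicit.
Unset Printing Implicit Defensive.

Import Order.TTheory GRing.Theory Num.Theory.
Import numFieldNormedType.Exports.

Local Open Scope classical_set_scope.
Local Open Scope ring_scope.

Record hypergraph := Hypergraph {
  vertices : finType;
  hyperedges : {set {set vertices}} }.

Definition uniform_hypergraph (k : nat) (G : hypergraph) : Prop :=
  forall e : {set vertices G}, e \in hyperedges G -> #|e| = k.

Definition hom_count (H G : hypergraph) : nat :=
  #|[set f : {ffun vertices H -> vertices G} |
      [forall e in hyperedges H, (f @: e)%SET \in hyperedges G]]%SET|.

(* The center is [None]; [Some (i, j)] is the j-th of the k - 1 non-central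
   vertices of the i-th branch. *)
Definition branch (k b : nat) (i : 'I_b) : {set option ('I_b * 'I_k.-1)} :=
  (None |: [set Some (i, j) | j : 'I_k.-1])%SET.

Definition hyperstar (k b : nat) : hypergraph :=
  @Hypergraph (option ('I_b * 'I_k.-1)%type)
    [set branch k i | i : 'I_b]%SET.

Lemma hyperstar_uniform (k b : nat) : (0 < k)%N -> uniform_hypergraph k (hyperstar k b).
Proof.
move=> k0 e /imsetP[i _ ->]; rewrite cardsU1 card_imset; last by move=> x y [].
rewrite card_ord; case: imsetP => [[j _ //]|_]; exact: prednK.
Qed.

Lemma card_hyperstar (k b : nat) :
  (1 < k)%N -> #|hyperedges (hyperstar k b)| = b.
Proof.
case: k => [|[|k]] // _; rewrite card_imset ?card_ord // => i i' eq_ii'.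
have: Some (i, ord0) \in branch k.+2 i' by rewrite -eq_ii' !inE imset_f.
by rewrite !inE /= => /imsetP[j _ [->]].
Qed.

Definition power_sum (R : realType) (n i : nat) (x : 'rV[R]_n) : R :=
  \sum_(j < n) x ord0 j ^+ i.

(* R^(l-1) is ['rV[R]_l.-1]: the coordinate of index j (from 0) carries the
   exponent j + 2. *)
Definition power_sum_points (R : realType) (n l : nat) : set 'rV[R]_l.-1 :=
  [set y | exists x : 'rV[R]_n,
     [/\ forall j, 0 <= x ord0 j,
         power_sum 1 x = 1
       & y = \row_(j < l.-1) power_sum (j + 2)%N x] ].

Definition power_sum_profile (R : realType) (l : nat) : set 'rV[R]_l.-1 :=
  closure (\bigcup_n @power_sum_points R n l).

Definition hyperstar_point (R : realType) (l k : nat) (G : hypergraph) :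
    'rV[R]_l.-1 :=
  \row_(j < l.-1) ((hom_count (hyperstar k ((j + 2) * k)%N) G)%:R
                   / (hom_count (hyperstar k k) G)%:R ^+ (j + 2)%N).

Definition hyperstar_profile (R : realType) (l k : nat) : set 'rV[R]_l.-1 :=
  closure [set y | exists G : hypergraph,
    [/\ uniform_hypergraph k G,
        hom_count (hyperstar k k) G <> 0%N
      & y = hyperstar_point R l k G] ].

Arguments power_sum_points : clear implicits.
Arguments power_sum_profile : clear implicits.
Arguments hyperstar_point : clear implicits.
Arguments hyperstar_profile : clear implicits.

(* Main.v *)
Require Import Defs.
From HB Require Import structures.
From mathcomp Require Import all_boot all_order all_algebra.
From mathcomp Require Import all_classical all_reals all_analysis.
From mathcomp Require Import zify.

(** A map of the hyperstar with b branches into G is a choice of the image v of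
    the center and of b maps of a branch onto hyperedges through v, so
    hom(S_b; G) = sum_v c_v ^ b, where c_v = (k-1)! deg v. Hence the point of G
    is the tuple of power sums of x_v = c_v ^ k / sum_u c_u ^ k.
    Conversely, given x, take the disjoint union of hyperstars with
    d_i = floor (N x_i ^ (1/k)) branches. The centers contribute
    sum_i d_i ^ b ~ N ^ b sum_i x_i ^ (b/k), while the leaves have degree 1 and
    contribute only O(N), which is negligible since b >= k >= 2. *)

Set Implicit Arguments.
Unset Strict Implicit.
Unset Printing Implicit Defensive.

(** * Homomorphisms from hyperstars and vertex degrees *)

Definition branch_maps (k : nat) (G : hypergraph) (v : vertices G) :
    {set {ffun 'I_k.-1 -> vertices G}} :=
  [set g : {ffun 'I_k.-1 -> vertices G} |
    (v |: [set g j | j : 'I_k.-1])%SET \in hyperedges G]%SET.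

(** Branches meet only in the center, so once its image v is fixed they are mapped independently of
    each other. *)
Lemma hom_count_hyperstar (k b : nat) (G : hypergraph) :
  hom_count (hyperstar k b) G = \sum_(v : vertices G) #|branch_maps k v| ^ b.
Proof.
pose phi (f : {ffun option ('I_b * 'I_k.-1) -> vertices G}) :
    vertices G * {ffun 'I_b -> {ffun 'I_k.-1 -> vertices G}} :=
  (f None, [ffun i => [ffun j => f (Some (i, j))]]).
have phi_inj : injective phi.
  move=> f g [fg0 /ffunP fgS]; apply/ffunP => -[[i j]|] //.
  by have := fgS i; rewrite !ffunE => /ffunP/(_ j); rewrite !ffunE.
rewrite /hom_count -(card_imset _ phi_inj).
(* Under [phi], homomorphisms become the pairs (v, F) with every F i a branch map at v. *)
transitivity #|[set p : vertices G * {ffun 'I_b -> {ffun 'I_k.-1 -> vertices G}}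
     | p.2 \in ffun_on (branch_maps k p.1)]%SET|.
  congr #|pred_of_set _|; apply/setP => -[v F]; rewrite inE /=.
  have im_branch (f : {ffun option ('I_b * 'I_k.-1) -> vertices G}) i :
     (f @: branch k i = f None |: [set (phi f).2 i j | j : 'I_k.-1])%SET.
    rewrite /branch imsetU1; congr (_ |: _)%SET; rewrite -imset_comp.
    by apply: eq_imset => j; rewrite /= !ffunE.
  apply/imsetP/ffun_onP => [[f] | FP].
    rewrite inE => /forall_inP fP ef i.
    have /= -> : F = (phi f).2 by rewrite -ef.
    have -> : v = f None by case: ef.
    by rewrite inE -im_branch fP // imset_f.
  pose f : {ffun option ('I_b * 'I_k.-1) -> vertices G} := [ffun o =>
    if o is Some p then F p.1 p.2 else v].
  have ef : (v, F) = phi f.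
    rewrite /phi ffunE; congr pair; apply/ffunP => i; rewrite ffunE.
    by apply/ffunP => j; rewrite !ffunE.
  exists f => //; rewrite inE; apply/forall_inP => _ /imsetP[i _ ->].
  by rewrite im_branch -ef /= ffunE; have := FP i; rewrite inE.
rewrite -sum1_card (eq_bigl (fun p : _ * _ => true && (p.2 \in ffun_on (branch_maps k p.1)))); last first.
  by move=> p; rewrite inE.
rewrite -(pair_big_dep xpredT (fun v F => F \in ffun_on (branch_maps k v)) (fun _ _ => 1)) /=.
by apply: eq_bigr => v _; rewrite sum1_card card_ffun_on card_ord.
Qed.

Definition degree (G : hypergraph) (v : vertices G) : nat :=
  #|[set e in hyperedges G | v \in e]%SET|.

(** Sort the branch maps at v by the hyperedge e they produce: those over e are the bijections from
    the k - 1 leaves onto e minus v. *)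
Lemma card_branch_maps (k : nat) (G : hypergraph) (v : vertices G) :
  (0 < k)%N -> uniform_hypergraph k G ->
  #|branch_maps k v| = (degree v * (k.-1)`!)%N.
Proof.
move=> k0 Gk; pose im (g : {ffun 'I_k.-1 -> vertices G}) := (v |: [set g j | j : 'I_k.-1])%SET.
rewrite -sum1_card (partition_big im (mem [set e in hyperedges G | v \in e]%SET)); last first.
  by move=> g; rewrite !inE => -> /=; rewrite eqxx.
rewrite /degree -sum_nat_const; apply: eq_bigr => e; rewrite !inE => /andP[eE ve].
have ek : #|(e :\ v)%SET| = k.-1 by rewrite -(Gk e eE) (cardsD1 v e) ve.
transitivity #|[set g : {ffun 'I_k.-1 -> vertices G} in ffun_on (mem (e :\ v)%SET) | injectiveb g]%SET|; last first.
  by rewrite card_inj_ffuns_on card_ord ek ffactnn.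
rewrite sum1dep_card; apply: eq_card => g; rewrite !inE.
apply/andP/andP => [[_ /eqP eg] | [/ffun_onP gev /injectiveP gi]].
  (* At most k - 1 of the k vertices of e come from g, so v is not among its values and g is
     injective. *)
  have : (v \notin [set g j | j : 'I_k.-1]%SET) + #|[set g j | j : 'I_k.-1]%SET| = k.
    by rewrite -cardsU1 -/(im g) eg; exact: Gk.
  have le1 : #|[set g j | j : 'I_k.-1]%SET| <= k.-1.
    by rewrite -[leqRHS]card_ord leq_imset_card.
  case: (boolP (v \in _)) => [_|vg] /= cardg; first by exfalso; move: cardg le1 k0; set q := #|_|; clear; lia.
  split.
    apply/ffun_onP => j; rewrite !inE -eg; apply/andP; split.
      by apply: contraNneq vg => <-; apply: imset_f.
    by rewrite !inE imset_f ?orbT.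
  have /imset_injP gi : #|[set g j | j : 'I_k.-1]%SET| == #|'I_k.-1|.
    by rewrite card_ord; move: cardg le1 k0; set q := #|_|; clear; lia.
  by apply/injectiveP => i j; apply: gi.
suff eg : im g = e by rewrite -/(im g) eg eE.
rewrite /im -[RHS](finset.setD1K ve); congr (_ |: _)%SET; apply/eqP.
rewrite eqEcard card_imset // card_ord ek leqnn andbT.
by apply/fintype.subsetP => _ /imsetP[j _ ->].
Qed.

(** * Homomorphism counts of star forests *)

(* Disjoint hyperstars, the i-th with d i branches; the leaves of the branches
   (i, m) with d i <= m < N are isolated vertices. *)
Definition star_edge (k n N : nat) (p : 'I_n * 'I_N) :
    {set 'I_n + ('I_n * 'I_N) * 'I_k.-1} :=
  (inl p.1 |: [set inr (p, j) | j : 'I_k.-1])%SET.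

Definition star_forest (k n N : nat) (d : 'I_n -> nat) : hypergraph :=
  @Hypergraph ('I_n + ('I_n * 'I_N) * 'I_k.-1)%type
    [set star_edge k p | p : 'I_n * 'I_N & p.2 < d p.1]%SET.

Lemma star_forest_uniform k n N (d : 'I_n -> nat) :
  (0 < k)%N -> uniform_hypergraph k (star_forest k N d).
Proof.
move=> k0 e /imsetP[p _ ->]; rewrite cardsU1 card_imset; last by move=> x y [].
by rewrite card_ord; case: imsetP => [[j _ //]|_]; exact: prednK.
Qed.

Lemma star_edge_inj k n N : (1 < k)%N -> injective (@star_edge k n N).
Proof.
case: k => [|[|k]] // _ p q epq.
have: inr (p, ord0) \in star_edge k.+2 q by rewrite -epq !inE imset_f.
by rewrite !inE /= => /imsetP[j _ [->]].
Qed.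

Lemma degree_star_center k n N (d : 'I_n -> nat) (i : 'I_n) :
  (1 < k)%N -> (d i <= N)%N ->
  @degree (star_forest k N d) (inl i) = d i.
Proof.
move=> k1 dN; rewrite /degree.
have -> : ([set e in hyperedges (star_forest k N d) | inl i \in e] =
   [set star_edge k (i, m) | m : 'I_N & m < d i])%SET.
  apply/setP => e; rewrite !inE; apply/andP/imsetP.
    move=> [/imsetP[[i' m]]]; rewrite inE /= => md -> {e}.
    rewrite !inE => /orP[/eqP[->]|/imsetP[] //].
    by exists m => //; rewrite inE.
  move=> [m]; rewrite inE => md ->; rewrite !inE eqxx; split=> //.
  by apply: imset_f; rewrite inE.
rewrite card_imset; last by move=> m m' /(star_edge_inj k1)[].
rewrite -sum1dep_card -(big_mkord (fun m => m < d i) (fun=> 1%N)).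
(* Since [d i <= N], the range below N contains all d i branch indices. *)
by rewrite -(big_nat_widen 0 _ _ xpredT) // sum_nat_const_nat subn0 muln1.
Qed.

(** A leaf determines its branch, so [star_edge k p] is the only possible hyperedge through it. The
    boolean is read as 0 or 1. *)
Lemma degree_star_leaf k n N (d : 'I_n -> nat) (p : 'I_n * 'I_N) (j : 'I_k.-1) :
  @degree (star_forest k N d) (inr (p, j)) = (p.2 < d p.1).
Proof.
rewrite /degree.
have -> : ([set e in hyperedges (star_forest k N d) | inr (p, j) \in e] =
   [set e in [:: star_edge k p] | p.2 < d p.1])%SET.
  apply/setP => e; rewrite !inE; apply/andP/andP.
    move=> [/imsetP[q]]; rewrite inE /= => md -> {e}.
    by rewrite !inE /= => /imsetP[j' _ [-> _]].
  move=> [/eqP-> pd]; split; first by apply: imset_f; rewrite inE.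
  by rewrite !inE imset_f.
case: (_ < _); first by rewrite /= -(cards1 (star_edge k p)); apply: eq_card => e; rewrite !inE andbT.
by apply: eq_card0 => e; rewrite !inE andbF.
Qed.

Lemma hom_count_star_forest k n N b (d : 'I_n -> nat) :
  (1 < k)%N -> (0 < b)%N -> (forall i, d i <= N)%N ->
  hom_count (hyperstar k b) (star_forest k N d) =
  ((k.-1)`! ^ b * (\sum_i d i ^ b + k.-1 * \sum_i d i))%N.
Proof.
move=> k1 b0 dN; have k0 := ltnW k1.
rewrite hom_count_hyperstar.
under eq_bigr => v _ do
  rewrite (card_branch_maps _ k0 (star_forest_uniform k0)) expnMn.
rewrite -big_distrl /= mulnC; congr (_ * _)%N.
rewrite big_sumType /=; congr (_ + _)%N.
  by apply: eq_bigr => i _; rewrite degree_star_center.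
transitivity (\sum_(q : ('I_n * 'I_N) * 'I_k.-1) (q.1.2 < d q.1.1))%N.
  (* Leaf degrees are 0 or 1, hence unchanged by the power b; for 0 this uses [0 < b]. *)
  by apply: eq_bigr => -[p j] _; rewrite degree_star_leaf /=; case: (_ < _); rewrite ?exp1n ?exp0n.
rewrite -(pair_bigA _ (fun (p : 'I_n * 'I_N) (j : 'I_k.-1) => p.2 < d p.1 : nat)) /=.
rewrite -(pair_bigA _ (fun (i : 'I_n) (m : 'I_N) => \sum_(j < k.-1) (m < d i))) /=.
rewrite big_distrr /=; apply: eq_bigr => i _.
under eq_bigr => m _ do rewrite sum_nat_const card_ord.
rewrite -big_distrr /=; congr (_ * _)%N.
rewrite -big_mkcond /= -(big_mkord (fun m => m < d i) (fun=> 1%N)).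
by rewrite -(big_nat_widen 0 _ _ xpredT) // sum_nat_const_nat subn0 muln1.
Qed.

Import Order.TTheory GRing.Theory Num.Theory.
Import numFieldNormedType.Exports.
Local Open Scope classical_set_scope.
Local Open Scope ring_scope.

(** * Hyperstar points are power-sum points *)

Lemma hyperstar_point_sub (R : realType) (l k : nat) (G : hypergraph) :
  hom_count (hyperstar k k) G <> 0%N ->
  power_sum_points R #|vertices G| l (hyperstar_point R l k G).
Proof.
move=> hom_neq0.
pose w (v : vertices G) : R := #|branch_maps k v|%:R.
pose S : R := (hom_count (hyperstar k k) G)%:R.
have S0 : S != 0 by rewrite pnatr_eq0; apply/eqP.
have homE b : (hom_count (hyperstar k b) G)%:R = \sum_v w v ^+ b :> R.
  by rewrite hom_count_hyperstar natr_sum; apply: eq_bigr => v _; rewrite natrX.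
(* The case i = 1 gives the normalization, the cases i = j + 2 the coordinates. *)
have sumE i : power_sum i (\row_(j < #|vertices G|) (w (enum_val j) ^+ k / S))
    = (hom_count (hyperstar k (i * k)) G)%:R / S ^+ i.
  rewrite homE mulr_suml /power_sum [RHS](reindex (@enum_val _ (vertices G))) /=; last first.
    by apply: onW_bij; apply: enum_val_bij.
  by apply: eq_bigr => j _; rewrite mxE expr_div_n -exprM mulnC.
exists (\row_j (w (enum_val j) ^+ k / S)); split.
- by move=> j; rewrite mxE divr_ge0 ?exprn_ge0 ?ler0n.
- by rewrite sumE mul1n expr1 divff.
- by apply/rowP => j; rewrite !mxE sumE.
Qed.

(** * Approximating power-sum points by star forests *)

Lemma cvg_truncn_scaled (R : realType) (a : R) : 0 <= a ->
  (Num.truncn (N.+1%:R * a))%:R / N.+1%:R @[N --> \oo] --> a.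
Proof.
move=> a0; apply: (@squeeze_cvgr _ _ _ _ (fun N => a - harmonic N) (fun=> a)).
- apply: nearW => N.
  have N0 : 0 < N.+1%:R :> R by rewrite ltr0n.
  have /truncn_itv/andP[le lt] : 0 <= N.+1%:R * a by rewrite mulr_ge0.
  apply/andP; split; last by rewrite ler_pdivrMr // [leRHS]mulrC.
  rewrite ler_pdivlMr // mulrBl /harmonic mulVf ?gt_eqF // lerBlDr mulrC.
  by apply: ltW; rewrite natr1.
- by rewrite -[X in _ --> X]subr0; apply: cvgB; [exact: cvg_cst|exact: cvg_harmonic].
- exact: cvg_cst.
Qed.

(* [hom_count (hyperstar k b) (star_forest k N d)] divided by
   [((k-1)! * N) ^ b]: the second summand comes from the leaves. *)
Definition scaled_sum (R : realType) (k n b N : nat) (d : 'I_n -> nat) : R :=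
  \sum_i ((d i)%:R / N%:R) ^+ b +
  (k.-1)%:R * (\sum_i ((d i)%:R / N%:R)) * N%:R^-1 ^+ b.-1.

Lemma hom_count_star_forestR (R : realType) k n b N (d : 'I_n -> nat) :
  (1 < k)%N -> (0 < b)%N -> (0 < N)%N -> (forall i, d i <= N)%N ->
  (hom_count (hyperstar k b) (star_forest k N d))%:R =
  ((k.-1)`!%:R * N%:R) ^+ b * scaled_sum R k b N d.
Proof.
move=> k1 b0 N0 dN; rewrite hom_count_star_forest // natrM natrX exprMn -mulrA.
have NR : N%:R != 0 :> R by rewrite pnatr_eq0 -lt0n.
congr (_ * _); rewrite natrD natrM !natr_sum /scaled_sum mulrDr; congr (_ + _).
  by rewrite mulr_sumr; apply: eq_bigr => i _; rewrite natrX -exprMn mulrC divfK.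
(* In the leaf term one factor 1/N goes with d i; the other b - 1 remain. *)
rewrite -mulr_suml -!mulrA mulrCA; congr (_ * _); rewrite mulrCA -[LHS]mulr1; congr (_ * _).
by rewrite -exprS prednK // exprVn divff // expf_neq0.
Qed.

Lemma cvg_exprn (R : realType) (u : nat -> R) (a : R) m :
  u N @[N --> \oo] --> a -> u N ^+ m @[N --> \oo] --> a ^+ m.
Proof. by move=> ua; apply: (cvg_comp u (fun x => x ^+ m) ua); exact: exprn_continuous. Qed.

Lemma cvg_scaled_sum (R : realType) k n b (a : 'I_n -> R) : (1 < b)%N ->
  (forall i, 0 <= a i) ->
  scaled_sum R k b N.+1 (fun i => Num.truncn (N.+1%:R * a i)) @[N --> \oo]
  --> \sum_i a i ^+ b.
Proof.
move=> b1 a0; rewrite -[X in _ --> X]addr0; apply: cvgD.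
  apply: cvg_big; first exact: add_continuous.
  by move=> i _; apply: cvg_exprn; exact: cvg_truncn_scaled.
rewrite -[X in _ --> X](mulr0 ((k.-1)%:R * \sum_i a i)); apply: cvgM.
  apply: cvgM; first exact: cvg_cst.
  apply: cvg_big; first exact: add_continuous.
  by move=> i _; exact: cvg_truncn_scaled.
(* As b > 1, a positive power of 1/N is left, and the leaf term vanishes in the limit. *)
have -> : 0 = 0 ^+ b.-1 :> R by case: b b1 => [|[|b]] // _; rewrite /= expr0n.
by apply: cvg_exprn; exact: cvg_harmonic.
Qed.

Lemma power_sum_points_sub (R : realType) (n l k : nat) : (2 <= k)%N ->
  power_sum_points R n l `<=` hyperstar_profile R l k.
Proof.
move=> k1 _ [x [x0 x1 ->]].
have k0 : (0 < k)%N := ltnW k1.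
pose a (i : 'I_n) : R := x ord0 i `^ k%:R^-1.
have a0 i : 0 <= a i by exact: powR_ge0.
have ak i : a i ^+ k = x ord0 i.
  by rewrite -powR_mulrn // -powRrM mulVf ?pnatr_eq0 -?lt0n // powRr1.
(* Each x_i is at most the total 1. This keeps the branch numbers [d N i] within the N + 1 available
   slots. *)
have a1 i : a i <= 1.
  rewrite -(ler_pXn2r k0) ?nnegrE // ak expr1n -x1 /power_sum (bigD1 i) //= expr1 lerDl.
  by apply: sumr_ge0 => j _; rewrite expr1.
have power_sumE m : power_sum m x = \sum_i a i ^+ (m * k).
  by apply: eq_bigr => i _; rewrite mulnC exprM ak.
pose d N i := Num.truncn (N.+1%:R * a i).
have dN N i : (d N i <= N.+1)%N.
  rewrite -(ler_nat R); apply: (@le_trans _ _ (N.+1%:R * a i)).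
    by rewrite truncn_le mulr_ge0.
  by rewrite ler_piMr.
pose u b N := scaled_sum R k b N.+1 (d N).
have u_cvg m : (0 < m)%N -> u (m * k)%N N @[N --> \oo] --> power_sum m x.
  by move=> m0; rewrite power_sumE; apply: cvg_scaled_sum => //; case: m m0 => // m _; nia.
have uk_cvg : u k N @[N --> \oo] --> (1 : R).
  by have := @u_cvg 1%N isT; rewrite mul1n x1.
(* The limit is p_1(x) = 1, so the denominators are eventually nonzero. *)
have uk_neq0 : \forall N \near \oo, u k N != 0.
  by exact: (cvgr_neq0 _ uk_cvg (oner_neq0 R)).
have pt_cvg j : u ((j + 2) * k)%N N / u k N ^+ (j + 2) @[N --> \oo]
    --> power_sum (j + 2) x.
  have -> : power_sum (j + 2) x = power_sum (j + 2) x / 1 ^+ (j + 2).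
    by rewrite expr1n divr1.
  apply: cvgM; first by apply: u_cvg; rewrite addn2.
  by apply: cvgV; [rewrite expr1n oner_neq0|exact: cvg_exprn].
(* The scaling factor occurs to the power (j + 2) k above and below, and cancels. *)
have ptE N : u k N != 0 -> hyperstar_point R l k (star_forest k N.+1 (d N)) =
    \row_(j < l.-1) (u ((j + 2) * k)%N N / u k N ^+ (j + 2)).
  move=> uN0; apply/rowP => j; rewrite !mxE !hom_count_star_forestR //; last by nia.
  rewrite [(_ * scaled_sum _ _ _ _ _) ^+ _]exprMn -exprM (mulnC k) -mulf_div divff ?mul1r //.
move=> B /nbhs_ballP[e /= e0 eB].
(* There are finitely many coordinates, so one N serves them all. *)
have near_pt : \forall N \near \oo, forall j : 'I_l.-1,
    ball (power_sum (j + 2) x) e (u ((j + 2) * k)%N N / u k N ^+ (j + 2)).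
  by apply: filter_forall => j; exact: (cvg_ball (@pt_cvg j)).
have [N [uN0 Nj]] := filter_ex (filterI uk_neq0 near_pt).
exists (hyperstar_point R l k (star_forest k N.+1 (d N))); split.
  exists (star_forest k N.+1 (d N)); split => //; first exact: star_forest_uniform.
  apply/eqP; rewrite -(pnatr_eq0 R) hom_count_star_forestR // mulf_neq0 //.
by apply: eB; split=> // i j; rewrite ptE // !mxE.
Qed.

Theorem theorem4p1 (R : realType) (l k : nat) (hl : (2 <= l)%N) (hk : (2 <= k)%N) :
  hyperstar_profile R l k = power_sum_profile R l.
Proof.
apply/seteqP; split.
  apply: closureS => _ [G [_ G0 ->]].
  by exists #|vertices G| => //; exact: hyperstar_point_sub.
(* The left side is its own closure, so it suffices to contain the power-sum points themselves. *)
have /closure_id -> : closed (hyperstar_profile R l k) by exact: closed_closure.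
by apply: closureS => y [n _]; exact: power_sum_points_sub.
Qed.
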